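(* For an integer $j$ and $n\ge0$ let $$W_n^{(j)}(z)=B_n\;{}_3F_2\left({-n,\ \alpha+n+j+1,\ 1-\beta-n(\alpha+j+n+1)\atop \alpha+j+1,\ -\beta-n(\alpha+j+n+1)};z\right),$$ $$B_n=\frac{(-\alpha-j-n)_n}{(\alpha+j+n+1)_n}\,\frac{(\alpha+n+j+1)n+\beta}{(\alpha+n+j)n+\beta}.$$ Then the $W_n^{(j)}$ are the monic Krall–Jacobi polynomials orthogonal on $[0,1]$ with weight $x^{\alpha+j}+\beta^{-1}\delta(x-1)$: for all $n,m\ge0$, $$\int_0^1x^{\alpha+j}\,W_n^{(j)}(x)W_m^{(j)}(x)\,dx+\beta^{-1}\,W_n^{(j)}(1)W_m^{(j)}(1)=q_n^{(j)}\,\delta_{nm}$$ with nonzero constants $q_n^{(j)}$.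
   Context: ${}_3F_2$ is the ordinary hypergeometric series (terminating here, summed over $0\le s\le n$) and $(a)_n=a(a+1)\cdots(a+n-1)$ is the Pochhammer symbol. Parameters: $\alpha\in\mathbb C\setminus\mathbb Z$, $\beta\in\mathbb C\setminus\{0\}$, with $\operatorname{Re}(\alpha+j)>-1$ (for convergence of the integral), and $n(\alpha+j+n)+\beta\ne0$, $n(\alpha+j+n+1)+\beta\ne0$ for all integers $n\ge1$. The term $\beta^{-1}\delta(x-1)$ denotes a mass $\beta^{-1}$ at the endpoint $x=1$.
   Formalization: When the lower parameter -β-n(α+j+n+1) is one of -1,…,-(n-1), which the hypotheses allow (e.g. α=1/2, j=0, β=-6, n=2), the series contains 0/0; there W_n is defined by its limit in β, i.e. (1+e)_s/(e)_s is read as (e+s)/e with e this parameter. *)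

(* Defs.v *)
From HB Require Import structures.
From mathcomp Require Import all_boot all_order all_algebra.
From mathcomp Require Import complex.
From mathcomp Require Import all_classical all_reals all_analysis.

Set Implicit Arguments.
Unset Strict Implicit.
Unset Printing Implicit Defensive.

Import Order.TTheory GRing.Theory Num.Theory.
Import numFieldNormedType.Exports.

Local Open Scope classical_set_scope.
Local Open Scope ring_scope.
Local Open Scope complex_scope.

Definition pochhammer (F : fieldType) (a : F) (s : nat) : F :=
  \prod_(i < s) (a + i%:R).

(* The sum over 0 <= s <= n of the 3F2 series, as a polynomial in z.  It is the
   3F2 series itself when some a_i is -n and no lower Pochhammer symbol of
   index at most n vanishes. *)
Definition hypergeom32 (F : fieldType) (n : nat) (a1 a2 a3 b1 b2 : F) :
    {poly F} :=
  \sum_(s < n.+1)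
    (pochhammer a1 s * pochhammer a2 s * pochhammer a3 s
     / (pochhammer b1 s * pochhammer b2 s * (s`!)%:R)) *: 'X^s.

Section KrallJacobi.
Variable R : realType.
Implicit Types (alpha beta : R[i]) (j : int) (n : nat).

Definition krallB alpha beta j n : R[i] :=
  let a := alpha + j%:~R in
  pochhammer (- a - n%:R) n / pochhammer (a + n%:R + 1) n
  * (((a + n%:R + 1) * n%:R + beta) / ((a + n%:R) * n%:R + beta)).

Definition krallW_formula alpha beta j n : {poly R[i]} :=
  let a := alpha + j%:~R in
  let e := - beta - n%:R * (a + n%:R + 1) in
  krallB alpha beta j n *:
    hypergeom32 n (- n%:R) (a + n%:R + 1) (1 + e) (a + 1) e.

(* If e = - beta - n (alpha + j + n + 1) is one of -1, ..., -(n - 1), the terms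
   of the 3F2 with (e)_s = 0 have (1 + e)_s / (e)_s of the form 0 / 0.  This is
   a removable singularity in beta, and W_n is then defined by continuity,
   coefficient by coefficient. *)
Definition krallW alpha beta j n : {poly R[i]} :=
  if pochhammer (- beta - n%:R * (alpha + j%:~R + n%:R + 1)) n != 0
  then krallW_formula alpha beta j n
  else \poly_(s < n.+1)
         lim ((fun b : R[i]^o => (krallW_formula alpha b j n)`_s : R[i]^o)
                @ (beta : R[i]^o)^').

(* x ^ a for x > 0, with the real logarithm of x; the value at x = 0 is
   irrelevant below. *)
Definition cpowR (x : R) (a : R[i]) : R[i] :=
  expR (complex.Re a * ln x) * cos (complex.Im a * ln x)
  +i* (expR (complex.Re a * ln x) * sin (complex.Im a * ln x)).

Definition cintegrable01 (f : R -> R[i]) : Prop :=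
  (@lebesgue_measure R).-integrable `[0, 1] (fun x => (complex.Re (f x))%:E) /\
  (@lebesgue_measure R).-integrable `[0, 1] (fun x => (complex.Im (f x))%:E).

Definition cintegral01 (f : R -> R[i]) : R[i] :=
  (\int[@lebesgue_measure R]_(x in `[0, 1]) complex.Re (f x))
  +i* (\int[@lebesgue_measure R]_(x in `[0, 1]) complex.Im (f x)).

End KrallJacobi.

(* Main.v *)
Require Import Defs.
From HB Require Import structures.
From mathcomp Require Import all_boot all_order all_algebra.
From mathcomp Require Import complex ring lra.
From mathcomp Require Import all_classical all_reals all_analysis.
From mathcomp Require Import measurable_realfun.

Set Implicit Arguments.
Unset Strict Implicit.
Unset Printing Implicit Defensive.

Import Order.TTheory GRing.Theory Num.Theory.
Import numFieldNormedType.Exports.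

Local Open Scope classical_set_scope.
Local Open Scope ring_scope.
Local Open Scope complex_scope.

(** Write [a = alpha + j] and let [P] be the Jacobi polynomial
    [2F1(-n, a+n+1; a+1; x)]. Since [(1+e)_s / (e)_s = (e+s) / e], one has
    [W_n = (B_n / e) (e P + x P')] with [e = -beta - n(a+n+1)], also where the
    defining series has a removable singularity. The coefficient recurrence
    of [P] (its hypergeometric equation), tested against [1] and [x^m], gives
    [P'(1) = n(a+n+1) P(1)] and a recurrence in [m] for the moments
    [int x^(a+m) P], which therefore vanish for [m < n]. By parts,
    [int x^(a+m) (e P + x P') = P(1)] for [m < n], while the mass at [1]
    contributes [(e + n(a+n+1)) P(1) / beta = -P(1)]. For [m = n] what is left
    is a nonzero multiple of the [n]-th moment. *)

(** * The algebra of the Krall-Jacobi polynomials *)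

Lemma pochhammerS (F : fieldType) (a : F) s :
  pochhammer a s.+1 = pochhammer a s * (a + s%:R).
Proof. exact: big_ord_recr. Qed.

Lemma pochhammer0 (F : fieldType) (a : F) : pochhammer a 0 = 1.
Proof. exact: big_ord0. Qed.

Lemma pochhammer_neq0 (F : fieldType) (a : F) n :
  (forall i, (i < n)%N -> a + i%:R != 0) -> pochhammer a n != 0.
Proof.
by move=> an; apply/prodf_neq0 => i _; exact: an.
Qed.

(** Taken at [a = e], this is [(1+e)_s / (e)_s = (e+s) / e] cleared of denominators. *)
Lemma pochhammer_shift (F : fieldType) (a : F) s :
  a * pochhammer (1 + a) s = pochhammer a s * (a + s%:R).
Proof.
elim: s => [|s IHs]; first by rewrite !pochhammer0 addr0 mulrC.
by rewrite pochhammerS mulrA IHs pochhammerS -natr1; ring.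
Qed.

(** Reading the product backwards turns its factors into [-(a + 1 + i)]. *)
Lemma pochhammer_reflect (F : fieldType) (a : F) n :
  pochhammer (- a - n%:R) n = (-1) ^+ n * pochhammer (a + 1) n.
Proof.
rewrite /pochhammer (reindex_inj rev_ord_inj) -[n in (-1) ^+ n]card_ord.
rewrite -prodrN; apply: eq_bigr => i _ /=.
rewrite natrB// -natr1; ring.
Qed.

Section KrallJacobiAlgebra.
Variables (F : numFieldType) (a : F).
Hypothesis a_neg : forall k : nat, a + k.+1%:R != 0.

Let a_neq0 k : a + k%:R + 1 != 0.
Proof. by rewrite -addrA natr1. Qed.

Let a1_neq0 k : a + 1 + k%:R != 0.
Proof. by rewrite -addrA nat1r. Qed.

(* The coefficients of the Jacobi polynomial 2F1(-n, a+n+1; a+1; x). *)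
Definition jacobi_coef n s : F :=
  pochhammer (- n%:R) s * pochhammer (a + n%:R + 1) s
  / (pochhammer (a + 1) s * s`!%:R).

Lemma jacobi_coefS n s :
  jacobi_coef n s.+1 * (s%:R + 1) * (a + s%:R + 1) =
  jacobi_coef n s * (s%:R - n%:R) * (a + n%:R + 1 + s%:R).
Proof.
have p0 : pochhammer (a + 1) s != 0 by apply: pochhammer_neq0.
have f0 : s`!%:R != 0 :> F by rewrite pnatr_eq0 -lt0n fact_gt0.
have s0 : s%:R + 1 != 0 :> F by rewrite natr1 pnatr_eq0.
rewrite /jacobi_coef !pochhammerS factS natrM -natr1.
by field; rewrite p0 f0 s0 a1_neq0.
Qed.

Lemma jacobi_coef_small n : jacobi_coef n n.+1 = 0.
Proof. by rewrite /jacobi_coef pochhammerS addNr mulr0 !mul0r. Qed.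

(* The hypergeometric equation in weak form, tested against v. *)
Lemma jacobi_ode n (v w : nat -> F) : (forall s, w s.+1 = v s) ->
  \sum_(s < n.+1) jacobi_coef n s * (s%:R - n%:R) * (a + n%:R + 1 + s%:R) * v s
  = \sum_(s < n.+1) jacobi_coef n s * s%:R * (a + s%:R) * w s.
Proof.
move=> wv.
(* The extra term [s = n + 1] vanishes with its coefficient, and the term [s = 0] with its factor
   [s], so [w 0] is arbitrary. *)
transitivity (\sum_(s < n.+2) jacobi_coef n s * s%:R * (a + s%:R) * w s).
  rewrite [RHS]big_ord_recl mulr0 !mul0r add0r; apply: eq_bigr => s _.
  by rewrite lift0 wv -jacobi_coefS -natr1 addrA.
by rewrite big_ord_recr /= jacobi_coef_small !mul0r addr0.
Qed.

(** Testing against [1] works because [(s-n)(a+n+1+s) - s(a+s) = s - n(a+n+1)]. *)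
Lemma jacobi_deriv1 n :
  \sum_(s < n.+1) jacobi_coef n s * s%:R =
  n%:R * (a + n%:R + 1) * \sum_(s < n.+1) jacobi_coef n s.
Proof.
have /eqP := @jacobi_ode n (fun=> 1) (fun=> 1) (fun=> erefl).
rewrite -subr_eq0 -sumrB => /eqP ode.
apply/eqP; rewrite -subr_eq0 mulr_sumr -sumrB -[X in _ == X]ode.
by apply/eqP/eq_bigr => s _; ring.
Qed.

(** For [Re a > -1] this is the integral of [x^(a+m) P] over [[0, 1]]. *)
Definition jacobi_moment n m : F :=
  \sum_(s < n.+1) jacobi_coef n s / (a + (m + s)%:R + 1).

(** Dividing [(s-n)(a+n+1+s)] by [a+m+s+1] and [s(a+s)] by [a+m+s] gives the same quotient [s - m].
    The remainders [(m-n)(a+m+n+1)] and [m(a+m)] are the factors here; the latter makes [m.-1]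
    harmless at [m = 0]. *)
Lemma jacobi_moment_rec n m :
  (m%:R - n%:R) * (a + m%:R + n%:R + 1) * jacobi_moment n m =
  m%:R * (a + m%:R) * jacobi_moment n m.-1.
Proof.
have := @jacobi_ode n (fun s => (a + (m + s)%:R + 1)^-1)
  (fun s => (a + (m + s)%:R)^-1).
have wv s : (a + (m + s.+1)%:R)^-1 = (a + (m + s)%:R + 1)^-1.
  by rewrite addnS -natr1 addrA.
move=> /(_ wv) /eqP; rewrite -subr_eq0 -sumrB => /eqP ode.
apply/eqP; rewrite -subr_eq0 !mulr_sumr -sumrB -[X in _ == X]ode.
apply/eqP/eq_bigr => s _; move: (a_neq0 (m + s)); rewrite natrD.
case: m {ode wv} => [|m] /=.
  (* At [m = s = 0] the weight is [1/a], and [a = 0] is allowed; the factor [s] removes this term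
     before any division by [a]. *)
  case: (nat_of_ord s) => [|k] H.
    rewrite add0n mulr0n !addr0 in H *.
    by rewrite mulr0 !mul0r !subr0; field.
  rewrite add0n mulr0n add0r in H *.
  move: (a_neg k) H; rewrite -natr1 => H1 H2.
  by field; rewrite H1 H2.
move: (a_neg (m + s)); rewrite -!natr1 natrD => H1 H2.
field; rewrite H2 andbT; move: H1; congr (_ != 0); ring.
Qed.

Lemma jacobi_moment_lt n m : (m < n)%N -> jacobi_moment n m = 0.
Proof.
elim: m => [|m IHm] mn; have := jacobi_moment_rec n _.
  move=> /(_ 0) /eqP; rewrite mul0r mul0r !mulf_eq0 => /orP[/orP[]|/eqP //].
    by rewrite sub0r oppr_eq0 pnatr_eq0 (gtn_eqF mn).
  by rewrite addr0 (negPf (a_neq0 n)).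
move=> /(_ m.+1) /eqP; rewrite /= IHm ?(ltnW mn)// mulr0.
rewrite !mulf_eq0 => /orP[/orP[]|/eqP //].
  by rewrite subr_eq0 eqr_nat (ltn_eqF mn).
by move: (a_neg (m.+1 + n)); rewrite -natr1 natrD !addrA => /negPf ->.
Qed.

(* The numerator of the partial fraction decomposition of the moments has
   degree at most n; if the n-th moment vanished too, it would have n + 1
   roots. *)
Lemma jacobi_moment_neq0 n : jacobi_moment n n != 0.
Proof.
apply/negP => /eqP Mn0.
pose b (s : nat) : {poly F} := 'X + (a + s%:R + 1)%:P.
pose Q := \sum_(s < n.+1) jacobi_coef n s *: \prod_(r < n.+1 | r != s) b r.
have sb s : size (b s) = 2 by rewrite size_XaddC.
have bE s x : (b s).[x] = x + (a + s%:R + 1) by rewrite hornerD hornerX hornerC.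
have sQ : (size Q <= n.+1)%N.
  apply: (leq_trans (size_sum _ _ _)); apply/bigmax_leqP => s _.
  rewrite (leq_trans (size_scale_leq _ _))// size_prod => [|r _]; last first.
    by rewrite -size_poly_eq0 sb.
  rewrite (eq_bigr (fun=> 2%N)) => [|r _]; last exact: sb.
  by rewrite sum_nat_const cardC1 card_ord /= muln2 -addnn -addSn addnK.
have rootQ m : (m <= n)%N -> root Q m%:R.
  move=> mn; rewrite rootE horner_sum; apply/eqP.
  transitivity ((\prod_(r < n.+1) (b r).[m%:R]) * jacobi_moment n m).
    rewrite mulr_sumr; apply: eq_bigr => s _.
    rewrite hornerZ horner_prod [X in _ = X * _](bigD1 s)//= bE.
    have := a_neq0 (m + s); rewrite natrD => ms.
    field; move: ms; congr (_ != 0); ring.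
  move: mn; rewrite leq_eqVlt => /predU1P[->|mn].
    by rewrite Mn0 mulr0.
  by rewrite jacobi_moment_lt ?mulr0.
have Q0 : Q = 0.
  apply: (@roots_geq_poly_eq0 _ _ [seq m%:R | m <- iota 0 n.+1]).
  - by apply/allP => _ /mapP[m + ->]; rewrite mem_iota add0n => /andP[_ /rootQ].
  - by rewrite map_inj_uniq ?iota_uniq// => x y /eqP; rewrite eqr_nat => /eqP.
  - by rewrite size_map size_iota.
(* At the root of [b 0] only the summand [s = 0] survives, so the zero polynomial would take the
   value [n!]. *)
have : Q.[- (a + 1)] = \prod_(r < n) r.+1%:R.
  rewrite horner_sum big_ord_recl [X in _ + X]big1 ?addr0 => [|s _].
    rewrite /jacobi_coef !pochhammer0 fact0 !mul1r invr1 scale1r horner_prod.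
    rewrite big_mkcond big_ord_recl /= mul1r; apply: eq_bigr => r _.
    by rewrite bE -[bump 0 r]/r.+1 -natr1; ring.
  rewrite hornerZ horner_prod (bigD1 ord0)//= bE.
  have -> : - (a + 1) + (a + 0%:R + 1) = 0 by ring.
  by rewrite mul0r mulr0.
rewrite Q0 horner0 => /esym/eqP; rewrite prodf_seq_eq0 => /hasP[r _ /=].
by rewrite pnatr_eq0.
Qed.

(* The integral of x ^ a p(x) over [0, 1]. *)
Definition mom (p : {poly F}) : F := \sum_(k < size p) p`_k / (a + k%:R + 1).

Lemma mom_widen N (p : {poly F}) : (size p <= N)%N ->
  mom p = \sum_(k < N) p`_k / (a + k%:R + 1).
Proof.
move=> pN; rewrite /mom (big_ord_widen N (fun k => p`_k / (a + k%:R + 1)) pN).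
rewrite big_mkcond; apply: eq_bigr => k _; case: ltnP => // /(nth_default 0) ->.
by rewrite mul0r.
Qed.

Lemma mom_linear : linear_for *%R mom.
Proof.
move=> c p q; pose N := maxn (size p) (size q).
have pN : (size p <= N)%N by exact: leq_maxl.
have qN : (size q <= N)%N by exact: leq_maxr.
rewrite (mom_widen pN) (mom_widen qN) (@mom_widen N); last first.
  rewrite (leq_trans (size_polyD _ _))// geq_max qN andbT.
  exact: leq_trans (size_scale_leq _ _) pN.
rewrite mulr_sumr -big_split; apply: eq_bigr => k _ /=.
by rewrite coefD coefZ mulrDl mulrA.
Qed.

HB.instance Definition _ :=
  GRing.isLinear.Build F {poly F} F *%R mom mom_linear.

Lemma momXn k : mom 'X^k = (a + k%:R + 1)^-1.
Proof.
rewrite /mom size_polyXn big_ord_recr /= coefXn eqxx mul1r big1 ?add0r// => i _.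
by rewrite coefXn ltn_eqF// mul0r.
Qed.

Lemma mom_poly n (w : nat -> F) m :
  mom ((\poly_(s < n) w s) * 'X^m) = \sum_(s < n) w s / (a + (m + s)%:R + 1).
Proof.
rewrite poly_def mulr_suml linear_sum; apply: eq_bigr => s _.
by rewrite -scalerAl linearZ /= -exprD momXn addnC.
Qed.

(** * Krall-Jacobi polynomials and their bilinear form *)

Variable beta : F.
Hypothesis beta_neq0 : beta != 0.
Hypothesis nondeg : forall n : nat, n%:R * (a + n%:R + 1) + beta != 0.
Hypothesis nondeg' : forall n : nat, n%:R * (a + n%:R) + beta != 0.

Definition krall_e n : F := - beta - n%:R * (a + n%:R + 1).

Lemma krall_e_neq0 n : krall_e n != 0.
Proof. by rewrite /krall_e -opprD oppr_eq0 addrC. Qed.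

Definition krall_B n : F :=
  pochhammer (- a - n%:R) n / pochhammer (a + n%:R + 1) n
  * (((a + n%:R + 1) * n%:R + beta) / ((a + n%:R) * n%:R + beta)).

(** The quotient [(e+s) / e] replaces [(1+e)_s / (e)_s], and so stays meaningful when [(e)_s]
    vanishes. *)
Definition krall_coef n s : F :=
  krall_B n * (jacobi_coef n s * ((krall_e n + s%:R) / krall_e n)).

Definition krall n : {poly F} := \poly_(s < n.+1) krall_coef n s.

Let poch_neq0 n : pochhammer (a + n%:R + 1) n != 0.
Proof.
apply: pochhammer_neq0 => i _; have := a_neg (n + i).
by rewrite -natr1 natrD; congr (_ != 0); ring.
Qed.

Let poch1_neq0 n : pochhammer (a + 1) n != 0.
Proof. by apply: pochhammer_neq0. Qed.

Lemma krall_B_neq0 n : krall_B n != 0.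
Proof.
rewrite /krall_B pochhammer_reflect ![_ * n%:R]mulrC.
by rewrite !(mulf_neq0, invr_neq0) ?signr_eq0.
Qed.

(** Since [e + n = -(n(a+n) + beta)], the quotient [(e+n) / e] cancels the last factor of [krall_B].
    The Pochhammer symbols cancel up to two signs [(-1)^n], one from [(-n)_n] and one from
    [(-a-n)_n]. *)
Lemma krall_lead n : krall_coef n n = 1.
Proof.
have e0 := krall_e_neq0 n.
have fN : pochhammer (- n%:R) n = (-1) ^+ n * n`!%:R :> F.
  have := pochhammer_reflect (0 : F) n; rewrite oppr0 sub0r add0r => ->.
  congr (_ * _); rewrite /pochhammer fact_prod big_add1 big_mkord natr_prod.
  by apply: eq_bigr => i _; rewrite nat1r.
have f0 : n`!%:R != 0 :> F by rewrite pnatr_eq0 -lt0n fact_gt0.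
have eE : krall_e n + n%:R = - (n%:R * (a + n%:R) + beta).
  by rewrite /krall_e; ring.
have dE : krall_e n = - (n%:R * (a + n%:R + 1) + beta).
  by rewrite /krall_e; ring.
rewrite /krall_coef /krall_B /jacobi_coef pochhammer_reflect fN eE dE.
have s2 : (-1) ^+ n * (-1) ^+ n = 1 :> F by rewrite -expr2 sqrr_sign.
rewrite -[RHS]s2; field.
by rewrite f0 poch_neq0 poch1_neq0 -[(a + n%:R) * _]mulrC nondeg' nondeg.
Qed.

Lemma size_krall n : size (krall n) = n.+1.
Proof. by rewrite size_poly_eq// krall_lead oner_neq0. Qed.

Lemma krall_monic n : krall n \is monic.
Proof.
by rewrite monicE lead_coefE size_krall coef_poly ltnSn krall_lead.
Qed.

Definition krall_form (p q : {poly F}) : F :=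
  mom (p * q) + beta^-1 * p.[1] * q.[1].

Lemma krall_formC p q : krall_form p q = krall_form q p.
Proof. by rewrite /krall_form mulrC -!mulrA [p.[1] * _]mulrC. Qed.

(* Up to a scalar, W_n = e P + x P' for the Jacobi polynomial P, and
   (e + s) / (a + m + 1 + s) = 1 + (e - a - m - 1) / (a + m + 1 + s), where the
   1 contributes P(1), which the point mass cancels. *)
Lemma krall_formXn n m :
  krall_form (krall n) 'X^m =
  krall_B n / krall_e n * (krall_e n - a - m%:R - 1) * jacobi_moment n m.
Proof.
rewrite /krall_form mom_poly hornerXn expr1n mulr1.
set e := krall_e n; set B := krall_B n.
set P1 := \sum_(s < n.+1) jacobi_coef n s.
have e0 : e != 0 := krall_e_neq0 n.
(* The value is [B/e] times [e P(1) + P'(1)], and [e + n(a+n+1) = -beta]. *)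
have -> : (krall n).[1] = B / e * (- beta * P1).
  rewrite /krall horner_poly.
  transitivity (B / e * (e * P1 + \sum_(s < n.+1) jacobi_coef n s * s%:R)).
    rewrite /P1 mulr_sumr -big_split mulr_sumr; apply: eq_bigr => s _ /=.
    by rewrite expr1n /krall_coef -/e -/B; field.
  rewrite jacobi_deriv1 -/P1 -mulrDl; congr (_ * (_ * _)).
  by rewrite /e /krall_e; ring.
transitivity (B / e * (P1 + (e - a - m%:R - 1) * jacobi_moment n m)
              - B / e * P1); last by ring.
congr (_ + _); last by field; rewrite beta_neq0 e0.
rewrite /P1 mulr_sumr -big_split mulr_sumr; apply: eq_bigr => s _ /=.
rewrite /krall_coef -/e -/B natrD.
have := a_neq0 (m + s); rewrite natrD => ms.
by field; rewrite e0 ms.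
Qed.

Lemma krall_formXn_lt n m : (m < n)%N -> krall_form (krall n) 'X^m = 0.
Proof. by move=> mn; rewrite krall_formXn jacobi_moment_lt// mulr0. Qed.

Lemma krall_formXn_neq0 n : krall_form (krall n) 'X^n != 0.
Proof.
(* This quantity is [-((n+1)(a+n+1) + beta)]. *)
have nn : krall_e n - a - n%:R - 1 != 0.
  have := nondeg' n.+1; rewrite -oppr_eq0 -natr1; congr (_ != 0).
  by rewrite /krall_e; ring.
rewrite krall_formXn; apply: mulf_neq0 (jacobi_moment_neq0 n).
apply: mulf_neq0 nn; apply: mulf_neq0 (krall_B_neq0 n) _.
by rewrite invr_eq0 krall_e_neq0.
Qed.

Lemma krall_form_poly n p : krall_form (krall n) p =
  \sum_(k < size p) p`_k * krall_form (krall n) 'X^k.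
Proof.
rewrite /krall_form -{1}[p]coefK poly_def mulr_sumr linear_sum /=.
rewrite [p.[1]]horner_coef mulr_sumr -big_split; apply: eq_bigr => k _ /=.
rewrite -scalerAr linearZ /= hornerXn expr1n; ring.
Qed.

(** By symmetry [m <= n]. Expanding the second polynomial in monomials leaves at most [X^n], present
    only for [m = n] and then with coefficient 1. *)
Lemma krall_orthogonal n m : krall_form (krall n) (krall m) =
  if n == m then krall_form (krall n) 'X^n else 0.
Proof.
wlog mn : n m / (m <= n)%N => [H|].
  case: (leqP m n) => [/H //|nm].
  by rewrite krall_formC H ?(ltnW nm)// eq_sym; case: eqP => // ->.
rewrite krall_form_poly size_krall big_ord_recr /= big1 ?add0r => [|k _].
  rewrite coef_poly ltnSn krall_lead mul1r.
  case: eqVneq mn => [->//|nm].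
  by rewrite leq_eqVlt eq_sym (negPf nm) => /krall_formXn_lt.
by rewrite krall_formXn_lt ?mulr0// (leq_trans (ltn_ord k)).
Qed.

End KrallJacobiAlgebra.

(** * Improper integrals of complex powers *)

Section LogOscillation.
Variable R : realType.
Local Notation mu := (@lebesgue_measure R).

(* The real and imaginary parts of c x ^ (u + i v), c complex, have this form. *)
Definition logosc (u v A B x : R) : R :=
  expR (u * ln x) * (A * cos (v * ln x) + B * sin (v * ln x)).

(** The function is the real part of [(A - iB) x^(u+iv)]; differentiation lowers [u] by one and
    multiplies [A - iB] by [u + iv]. *)
Lemma is_derive_logosc (u v A B x : R) : 0 < x ->
  is_derive x 1 (logosc u v A B)
    (logosc (u - 1) v (u * A + v * B) (u * B - v * A) x).
Proof.
move=> x0; have dln := is_derive1_ln x0.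
have dl (c : R) : is_derive x 1 (fun y => c * ln y) (c * x^-1).
  exact: is_deriveZ.
have dE : is_derive x 1 (fun y => expR (u * ln y)) (expR (u * ln x) * (u * x^-1)).
  exact: is_derive1_comp.
have dC : is_derive x 1 (fun y => cos (v * ln y)) (- sin (v * ln x) * (v * x^-1)).
  exact: is_derive1_comp.
have dS : is_derive x 1 (fun y => sin (v * ln y)) (cos (v * ln x) * (v * x^-1)).
  exact: is_derive1_comp.
have dCS := is_deriveD (is_deriveZ A dC) (is_deriveZ B dS).
apply: is_derive_eq (is_deriveM dE dCS) _.
rewrite !fctE /logosc mulrBl mul1r expRB lnK ?posrE//= /GRing.scale/=.
by field; rewrite gt_eqF.
Qed.

Lemma continuous_logosc (u v A B x : R) : 0 < x ->
  {for x, continuous (logosc u v A B)}.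
Proof.
move=> /(is_derive_logosc u v A B) d.
by apply: differentiable_continuous; apply/derivable1_diffP; exact: ex_derive.
Qed.

Lemma measurable_logosc (u v A B : R) D : measurable_fun D (logosc u v A B).
Proof.
have mln (c : R) : measurable_fun setT (fun x : R => c * ln x).
  by apply: measurable_funM => //; exact: measurable_ln.
apply/measurable_funTS/measurable_funM.
  by apply: measurableT_comp (mln u); exact: measurable_expR.
apply: measurable_funD; apply: measurable_funM => //;
  apply: measurableT_comp (mln v);
  apply: continuous_measurable_fun;
  [exact: continuous_cos|exact: continuous_sin].
Qed.

Lemma logosc_le (u v A B x : R) :
  `|logosc u v A B x| <= (`|A| + `|B|) * expR (u * ln x).
Proof.
rewrite normrM [leLHS]mulrC (ger0_norm (expR_ge0 _)) ler_wpM2r ?expR_ge0//.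
rewrite (le_trans (ler_normD _ _))// !normrM lerD// ler_piMr//.
- by rewrite ler_norml cos_le1 cos_geN1.
- by rewrite ler_norml sin_le1 sin_geN1.
Qed.

Lemma logosc_at0 (u v A B : R) : 0 < u ->
  logosc u v A B n.+2%:R^-1 @[n --> \oo] --> (0 : R).
Proof.
move=> u0; apply/cvgrPdist_lt => e e0.
pose C := `|A| + `|B| + 1.
have C0 : 0 < C by rewrite /C ltr_wpDl// addr_ge0.
(* The threshold is [(e/C)^(1/u)], below which [C x^u < e]. *)
have d0 : 0 < expR (ln (e / C) / u) by exact: expR_gt0.
have := @cvg_harmonic R; move/cvgrPdist_lt => /(_ _ d0).
case=> N _ HN; exists N => // n /= Nn.
have := HN n.+1 (leqW Nn); rewrite /= !sub0r !normrN => h.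
have p0 : 0 < n.+2%:R^-1 :> R by rewrite invr_gt0.
rewrite ger0_norm ?ltW// in h.
have eC : 0 < e / C by rewrite divr_gt0.
apply: le_lt_trans (logosc_le _ _ _ _ _) _.
rewrite -[ltRHS](divfK (lt0r_neq0 C0)) [ltRHS]mulrC.
apply: (@le_lt_trans _ _ (C * expR (u * ln n.+2%:R^-1))).
  by rewrite ler_wpM2r ?expR_ge0// /C lerDl.
rewrite ltr_pM2l// -ltr_ln ?posrE ?expR_gt0//.
by rewrite expRK mulrC -ltr_pdivlMr// -ltr_expR lnK ?posrE.
Qed.

(** The primitive takes the value [A] at 1 because [ln 1 = 0]. The shift [n + 2] keeps the left
    endpoint strictly below 1. *)
Lemma integral_logosc_itv (u v A B : R) (n : nat) :
  (\int[mu]_(x in `[(n.+2%:R^-1 : R)%R, 1%R])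
    (logosc (u - 1) v (u * A + v * B) (u * B - v * A) x)%R%:E =
   (A - logosc u v A B n.+2%:R^-1)%R%:E)%E.
Proof.
have p0 : 0 < n.+2%:R^-1 :> R by rewrite invr_gt0.
have p1 : n.+2%:R^-1 < 1 :> R by rewrite invf_lt1// ltr1n.
rewrite (@continuous_FTC2 _ _ (logosc u v A B))//.
- by rewrite /logosc ln1 !mulr0 expR0 cos0 sin0 mulr0 addr0 mulr1 mul1r EFinB.
- apply: continuous_in_subspaceT => x /set_mem/=; rewrite in_itv/= => /andP[px _].
  exact/continuous_logosc/(lt_le_trans p0).
- split.
  + move=> x; rewrite in_itv/= => /andP[px _].
    by have := is_derive_logosc u v A B (lt_trans p0 px) => ?; exact: ex_derive.
  + exact/cvg_at_right_filter/continuous_logosc.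
  + exact/cvg_at_left_filter/continuous_logosc.
- move=> x; rewrite in_itv/= => /andP[px _].
  rewrite derive1E; have := is_derive_logosc u v A B (lt_trans p0 px).
  by move=> ?; exact: derive_val.
Qed.

Let D : set R := `]0, 1].
Let E n : set R := `[n.+2%:R^-1, 1].

Let mD : measurable D. Proof. exact: measurable_itv. Qed.

Let DE n : D `&` E n = E n.
Proof.
apply/seteqP; split=> [x []//|x Ex]; split=> //; move: Ex.
rewrite /E /D /= !in_itv/= => /andP[nx ->]; rewrite andbT.
by apply: lt_le_trans nx; rewrite invr_gt0.
Qed.

Let cvg_restrict (f : R -> R) x : D x ->
  (EFin \o f) \_ (E n) x @[n --> \oo] --> (f x)%:E.
Proof.
rewrite /D /= in_itv/= => /andP[x0 x1]; apply: cvg_near_cst.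
have := @cvg_harmonic R; move/cvgrPdist_lt => /(_ _ x0).
case=> N _ HN; exists N => // n /= Nn.
have := HN n.+1 (leqW Nn); rewrite /= !sub0r !normrN => h.
rewrite ger0_norm in h; last by rewrite invr_ge0.
by rewrite /patch mem_set//= /E /= in_itv/= x1 ltW.
Qed.

Let measurable_restrict (u v A B : R) n :
  measurable_fun D ((EFin \o logosc u v A B) \_ (E n)).
Proof.
apply/measurable_restrict => //.
  exact: measurable_itv.
by apply/measurable_EFinP; exact: measurable_logosc.
Qed.

Let limn_restrict (f : R -> R) x : D x ->
  limn (fun n => ((EFin \o f) \_ (E n)) x) = (f x)%:E.
Proof. by move=> Dx; apply/cvg_lim => //; exact: cvg_restrict. Qed.

(** Monotone convergence over the growing intervals [E n] gives the finite integral [1/u]. This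
    power serves as the dominating function below. *)
Lemma integrable_expR_ln (u : R) : 0 < u ->
  mu.-integrable `]0, 1] (fun x : R => (expR ((u - 1) * ln x))%:E).
Proof.
move=> u0.
(* Left unsimplified to match [integral_logosc_itv] with primitive [x^u / u]. *)
pose h := logosc (u - 1) 0 (u * u^-1 + 0 * 0) (u * 0 - 0 * u^-1).
have hE x : h x = expR ((u - 1) * ln x).
  rewrite /h /logosc !mul0r cos0 mulr0 subrr mul0r !addr0 mulr1 divff ?mulr1//.
  by rewrite gt_eqF.
have h0 x : 0 <= h x by rewrite hE expR_ge0.
apply/integrableP; split.
  apply/measurable_EFinP.
  rewrite (_ : (fun x => _) = h); first exact: measurable_logosc.
  by apply/funext => x; rewrite hE.
under eq_integral do rewrite -hE gee0_abs ?lee_fin ?h0//.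
pose k n := (EFin \o h) \_ (E n).
have -> : (\int[mu]_(x in D) (h x)%:E = \int[mu]_(x in D) limn (k ^~ x))%E.
  by apply: eq_integral => x /set_mem Dx; rewrite limn_restrict.
have k0 n x : D x -> (0 <= k n x)%E.
  by move=> _; rewrite /k /patch; case: ifP => // _; rewrite lee_fin; exact: h0.
have knd x : D x -> {homo k ^~ x : n m / (n <= m)%N >-> (n <= m)%E}.
  move=> Dx n m nm; rewrite /k /patch; case: ifPn => [/set_mem/= Enx|_].
    rewrite mem_set//; move: Enx; rewrite /E /= !in_itv/= => /andP[+ ->].
    rewrite andbT; apply: le_trans; rewrite lef_pV2 ?posrE// ler_nat.
    by rewrite !ltnS.
  by case: ifP => // _; rewrite lee_fin; exact: h0.
have mk n : measurable_fun D (k n) by exact: measurable_restrict.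
have kcvg : (\int[mu]_(x in D) k n x @[n --> \oo] --> (u^-1)%:E)%E.
  rewrite /k; under eq_fun do rewrite -integral_mkcondr DE integral_logosc_itv.
  apply: cvg_EFin; first exact: nearW.
  rewrite -[X in _ --> X]subr0; apply: cvgB; first exact: cvg_cst.
  exact: logosc_at0.
have mcvg : (\int[mu]_(x in D) k n x @[n --> \oo] -->
             \int[mu]_(x in D) limn (k ^~ x))%E.
  exact: cvg_monotone_convergence.
by rewrite -(cvg_unique _ kcvg mcvg) ?ltry.
Qed.

(** Dominated convergence by a multiple of [x^(u-1)]; the primitive tends to 0 at the origin and
    equals [A] at 1. *)
Lemma integral_logosc (u v A B : R) : 0 < u ->
  let f := logosc (u - 1) v (u * A + v * B) (u * B - v * A) in
  mu.-integrable `]0, 1] (EFin \o f) /\ \int[mu]_(x in `]0, 1]) f x = A.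
Proof.
move=> u0 f; set A' := u * A + v * B in f *; set B' := u * B - v * A in f *.
pose C := `|A'| + `|B'|.
pose k n := (EFin \o f) \_ (E n).
have [|||//|//|intf _ cvgf] := @dominated_convergence _ _ _ mu D mD k (EFin \o f)
  (fun x => (C%:E * (expR ((u - 1) * ln x))%:E)%E).
- by move=> n; exact: measurable_restrict.
- by apply/measurable_EFinP; exact: measurable_logosc.
- by apply: aeW => x Dx; exact: cvg_restrict.
- by apply: integrableZl => //; exact: integrable_expR_ln.
- apply: aeW => x n _; rewrite /k /patch; case: ifP => _.
    by rewrite /= -EFinM lee_fin logosc_le.
  by rewrite abse0 -EFinM lee_fin mulr_ge0 ?expR_ge0// addr_ge0.
split=> //; rewrite /Rintegral.
have : (\int[mu]_(x in D) k n x @[n --> \oo] --> A%:E)%E.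
  rewrite /k; under eq_fun do rewrite -integral_mkcondr DE integral_logosc_itv.
  apply: cvg_EFin; first exact: nearW.
  rewrite -[X in _ --> X]subr0; apply: cvgB; first exact: cvg_cst.
  exact: logosc_at0.
by move=> kA; rewrite (cvg_unique _ cvgf kA).
Qed.

End LogOscillation.

(** * Complex-valued integrals over the unit interval *)

Section ComplexIntegral.
Variable R : realType.
Local Notation mu := (@lebesgue_measure R).
Implicit Types (f g : R -> R[i]) (b c v w : R[i]).

Lemma complexEReIm (z : R[i]) : z = complex.Re z +i* complex.Im z.
Proof. by case: z. Qed.

Lemma ReD (z w : R[i]) : complex.Re (z + w) = complex.Re z + complex.Re w.
Proof. by case: z; case: w. Qed.

Lemma ImD (z w : R[i]) : complex.Im (z + w) = complex.Im z + complex.Im w.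
Proof. by case: z; case: w. Qed.

(** The minus sign sits inside a factor to fit the shape [c * h + d * k] of [integrable_lin]. *)
Lemma Re_mulc (z w : R[i]) : complex.Re (z * w) =
  complex.Re z * complex.Re w + (- complex.Im z) * complex.Im w.
Proof. by case: z; case: w => ? ? ? ? /=; rewrite mulNr. Qed.

Lemma Im_mulc (z w : R[i]) : complex.Im (z * w) =
  complex.Re z * complex.Im w + complex.Im z * complex.Re w.
Proof. by case: z; case: w. Qed.

(* The origin is left out, where [cpowR] takes a junk value. *)
Definition is_cintegral f v : Prop :=
  [/\ mu.-integrable `]0, 1] (EFin \o (fun x => complex.Re (f x))),
      mu.-integrable `]0, 1] (EFin \o (fun x => complex.Im (f x))),
      \int[mu]_(x in `]0, 1]) complex.Re (f x) = complex.Re v &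
      \int[mu]_(x in `]0, 1]) complex.Im (f x) = complex.Im v].

Let mD : measurable (`]0, 1] : set R). Proof. exact: measurable_itv. Qed.

Lemma eq_is_cintegral f g v : {in (`]0, 1]%classic : set R), f =1 g} ->
  is_cintegral f v -> is_cintegral g v.
Proof.
move=> fg [iRe iIm eRe eIm]; split.
- by apply: eq_integrable iRe => // x Dx; rewrite /= fg.
- by apply: eq_integrable iIm => // x Dx; rewrite /= fg.
- by rewrite -eRe; apply: eq_Rintegral => x Dx; rewrite fg.
- by rewrite -eIm; apply: eq_Rintegral => x Dx; rewrite fg.
Qed.

Let integrable_lin (h k : R -> R) (c d : R) :
  mu.-integrable `]0, 1] (EFin \o h) -> mu.-integrable `]0, 1] (EFin \o k) ->
  mu.-integrable `]0, 1] (EFin \o (fun x => c * h x + d * k x)) /\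
  \int[mu]_(x in `]0, 1]) (c * h x + d * k x) =
  c * \int[mu]_(x in `]0, 1]) h x + d * \int[mu]_(x in `]0, 1]) k x.
Proof.
move=> ih ik.
have ih' : mu.-integrable `]0, 1] (fun x => (c%:E * (h x)%:E)%E).
  by apply: integrableZl.
have ik' : mu.-integrable `]0, 1] (fun x => (d%:E * (k x)%:E)%E).
  by apply: integrableZl.
split; first by apply: (integrableD _ ih' ik').
by rewrite RintegralD// !RintegralZl.
Qed.

Lemma is_cintegralD f g v w : is_cintegral f v -> is_cintegral g w ->
  is_cintegral (fun x => f x + g x) (v + w).
Proof.
move=> [iRf iIf eRf eIf] [iRg iIg eRg eIg].
have [iR eR] := integrable_lin 1 1 iRf iRg.
have [iI eI] := integrable_lin 1 1 iIf iIg.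
split.
- by apply: eq_integrable iR => // x _; rewrite /= ReD !mul1r.
- by apply: eq_integrable iI => // x _; rewrite /= ImD !mul1r.
- rewrite ReD -eRf -eRg -[X in X + _]mul1r -[X in _ + X]mul1r -eR.
  by apply: eq_Rintegral => x _; rewrite ReD !mul1r.
- rewrite ImD -eIf -eIg -[X in X + _]mul1r -[X in _ + X]mul1r -eI.
  by apply: eq_Rintegral => x _; rewrite ImD !mul1r.
Qed.

Lemma is_cintegralZ f c v : is_cintegral f v ->
  is_cintegral (fun x => c * f x) (c * v).
Proof.
move=> [iRf iIf eRf eIf].
have [iR eR] := integrable_lin (complex.Re c) (- complex.Im c) iRf iIf.
have [iI eI] := integrable_lin (complex.Re c) (complex.Im c) iIf iRf.
split.
- by apply: eq_integrable iR => // x _; rewrite /= Re_mulc.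
- by apply: eq_integrable iI => // x _; rewrite /= Im_mulc.
- rewrite Re_mulc -eRf -eIf -eR.
  by apply: eq_Rintegral => x _; rewrite Re_mulc.
- rewrite Im_mulc -eRf -eIf -eI.
  by apply: eq_Rintegral => x _; rewrite Im_mulc.
Qed.

Lemma is_cintegral_sum n (f_ : nat -> R -> R[i]) (v_ : nat -> R[i]) :
  (forall k, is_cintegral (f_ k) (v_ k)) ->
  is_cintegral (fun x => \sum_(k < n) f_ k x) (\sum_(k < n) v_ k).
Proof.
move=> fv; elim: n => [|n IHn].
  rewrite big_ord0; have := is_cintegralZ 0 (fv 0%N); rewrite mul0r.
  by apply: eq_is_cintegral => x _; rewrite big_ord0 mul0r.
rewrite big_ord_recr; apply: eq_is_cintegral (is_cintegralD IHn (fv n)) => x _.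
by rewrite big_ord_recr.
Qed.

Lemma is_cintegral_cpowR b : -1 < complex.Re b ->
  is_cintegral (fun x => cpowR x b) (b + 1)^-1.
Proof.
move=> b1; pose u := complex.Re b + 1; pose v := complex.Im b.
have u0 : 0 < u by rewrite /u; lra.
have N0 : u ^+ 2 + v ^+ 2 != 0.
  by rewrite gt_eqF// ltr_wpDr ?sqr_ge0// exprn_gt0.
have bE : complex.Re b = u - 1 by rewrite /u addrK.
(* The constants solve [(uA + vB, uB - vA) = (1, 0)] for the cosine part and [(0, 1)] for the sine
   part. The two values of [A] are the real and imaginary parts of [1/(u+iv)]. *)
have [iR eR] := integral_logosc v (u / (u ^+ 2 + v ^+ 2)) (v / (u ^+ 2 + v ^+ 2)) u0.
have [iI eI] := integral_logosc v (- v / (u ^+ 2 + v ^+ 2)) (u / (u ^+ 2 + v ^+ 2)) u0.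
have RE x : logosc (u - 1) v
    (u * (u / (u ^+ 2 + v ^+ 2)) + v * (v / (u ^+ 2 + v ^+ 2)))
    (u * (v / (u ^+ 2 + v ^+ 2)) - v * (u / (u ^+ 2 + v ^+ 2))) x =
    complex.Re (cpowR x b).
  by rewrite /logosc /cpowR /= bE -/v; field.
have IE x : logosc (u - 1) v
    (u * (- v / (u ^+ 2 + v ^+ 2)) + v * (u / (u ^+ 2 + v ^+ 2)))
    (u * (u / (u ^+ 2 + v ^+ 2)) - v * (- v / (u ^+ 2 + v ^+ 2))) x =
    complex.Im (cpowR x b).
  by rewrite /logosc /cpowR /= bE -/v; field.
have -> : (b + 1)^-1 = u / (u ^+ 2 + v ^+ 2) +i* (- v / (u ^+ 2 + v ^+ 2)).
  rewrite [b]complexEReIm -/v bE; apply/eqP; rewrite eq_complex /=.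
  by rewrite addr0 subrK mulNr; apply/andP; split; apply/eqP; rewrite ?mulrN.
split.
- by apply: eq_integrable iR => // x _; rewrite /= RE.
- by apply: eq_integrable iI => // x _; rewrite /= IE.
- by rewrite -[RHS]eR; apply: eq_Rintegral => x _; rewrite RE.
- by rewrite -[RHS]eI; apply: eq_Rintegral => x _; rewrite IE.
Qed.

Lemma cpowRDn (x : R) b k : 0 < x ->
  cpowR x (b + k%:R) = cpowR x b * x%:C ^+ k.
Proof.
move=> x0; elim: k => [|k IHk]; first by rewrite addr0 expr0 mulr1.
rewrite exprSr mulrA -IHk -natr1 addrA; set c := b + k%:R.
rewrite /cpowR ReD ImD /= addr0 mulrDl mul1r expRD lnK ?posrE//.
by apply/eqP; rewrite eq_complex /= !mulr0 subr0 add0r; apply/andP; split;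
  apply/eqP; ring.
Qed.

(** This links the algebraic functional [mom] to analysis, term by term through
    [x^b x^k = x^(b+k)]. *)
Lemma is_cintegral_cpowR_poly b (p : {poly R[i]}) : -1 < complex.Re b ->
  is_cintegral (fun x => cpowR x b * p.[x%:C]) (mom b p).
Proof.
move=> b1.
pose f_ k x := p`_k * cpowR x (b + k%:R).
have : is_cintegral (fun x => \sum_(k < size p) f_ k x) (mom b p).
  apply: (is_cintegral_sum _ (v_ := fun k => p`_k / (b + k%:R + 1))) => k.
  apply: is_cintegralZ; apply: is_cintegral_cpowR; rewrite ReD.
  have -> : complex.Re (k%:R : R[i]) = k%:R.
    by elim: k => // k IHk; rewrite -!natr1 ReD IHk.
  by rewrite ltr_wpDr.
apply: eq_is_cintegral => x /set_mem /=; rewrite in_itv/= => /andP[x0 _].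
rewrite horner_coef mulr_sumr; apply: eq_bigr => k _.
by rewrite /f_ cpowRDn//; ring.
Qed.

(** The origin is a null set. *)
Lemma is_cintegral01 f v : is_cintegral f v ->
  cintegrable01 f /\ cintegral01 f = v.
Proof.
move=> [iR iI eR eI].
have D0 : (`[0, 1] `\` [set 0] : set R) = `]0, 1]%classic.
  apply/seteqP; split=> x /=; rewrite !in_itv/=.
    by move=> [/andP[x0 ->] /eqP xn0]; rewrite lt_neqAle eq_sym xn0 x0.
  by move=> /andP[x0 ->]; split; [rewrite ltW|apply/eqP; rewrite gt_eqF].
have int01 (h : R -> R) : mu.-integrable `]0, 1] (EFin \o h) ->
    mu.-integrable `[0, 1] (EFin \o h).
  move=> ih; apply/(@negligible_integrable _ _ _ mu _ [set 0]) => //.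
  - by apply/emeasurable_fun_itv_obnd_cbndP; have /integrableP[] := ih.
  - exact: lebesgue_measure_set1.
  - by rewrite D0.
split; first by split; exact: int01.
rewrite /cintegral01 -!Rintegral_itv_obnd_cbnd// eR eI.
by rewrite -complexEReIm.
Qed.

End ComplexIntegral.

(** * Continuity in [beta] at removable singularities *)

Section RemovableSingularity.
Variable K : numFieldType.

(** Each factor is injective in [b]: either it is nonzero at [b0], hence nearby, or [b0] is its only
    zero and the punctured neighbourhood avoids it. *)
Lemma near_pochhammer_neq0 (c b0 : K^o) n :
  \forall b \near b0^', pochhammer (- b - c : K) n != 0.
Proof.
suff : \forall b \near b0^', forall i : 'I_n, (- b - c : K) + i%:R != 0.
  by apply: filterS => b H; apply/prodf_neq0 => i _; exact: H.
apply: filter_forall => i.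
have cv : ((- b - c + i%:R : K^o) @[b --> b0^'] --> (- b0 - c + i%:R : K^o)).
  apply: cvg_within_filter.
  apply: cvgD; last exact: cvg_cst.
  by apply: cvgB; [exact: cvgN|exact: cvg_cst].
case: (eqVneq (- b0 - c + i%:R) 0) => [e0|]; last exact: cvgr_neq0 cv.
have := nbhs_dnbhs_neq b0; apply: filterS => b; apply: contra_neq => e1.
by move: (etrans e1 (esym e0)) => /addIr/addIr/oppr_inj.
Qed.

Lemma cvg_krall_coef (T : Type) (F : set_system T) (FF : Filter F)
  (f : T -> K) (a b0 : K) n s :
  (a + n%:R) * n%:R + b0 != 0 -> krall_e a b0 n != 0 ->
  f x @[x --> F] --> b0 ->
  krall_coef a (f x) n s @[x --> F] --> krall_coef a b0 n s.
Proof.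
move=> d0 e0 fb.
have ce : krall_e a (f x) n @[x --> F] --> krall_e a b0 n.
  by apply: cvgB; [exact: cvgN|exact: cvg_cst].
have cE : (krall_e a (f x) n + s%:R) / krall_e a (f x) n @[x --> F] -->
    (krall_e a b0 n + s%:R) / krall_e a b0 n.
  by apply: cvgM; [apply: cvgD => //; exact: cvg_cst|exact: cvgV].
have cB : krall_B a (f x) n @[x --> F] --> krall_B a b0 n.
  apply: cvgM; first exact: cvg_cst.
  apply: cvgM; first by apply: cvgD => //; exact: cvg_cst.
  by apply: cvgV => //; apply: cvgD => //; exact: cvg_cst.
apply: cvgM cB _.
by apply: cvgM cE; exact: cvg_cst.
Qed.

End RemovableSingularity.

(** * Identification of [krallW] with [krall] *)

Lemma krallW_formulaE (R : realType) (alpha beta : R[i]) (j : int) n :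
  let a := alpha + j%:~R in
  krall_e a beta n != 0 -> pochhammer (krall_e a beta n) n != 0 ->
  krallW_formula alpha beta j n = krall a beta n.
Proof.
move=> a e0 en0.
rewrite /krallW_formula /hypergeom32 -/a -/(krall_e a beta n) /krall poly_def.
rewrite scaler_sumr; apply: eq_bigr => s _; rewrite scalerA; congr (_ *: _).
have es0 : pochhammer (krall_e a beta n) s != 0.
  apply: pochhammer_neq0 => i is_; have /prodf_neq0 := en0.
  by move=> /(_ (Ordinal (leq_trans is_ (ltn_ord s : s <= n)%N))); exact.
rewrite /krall_coef /jacobi_coef; congr (_ * _).
have -> : pochhammer (1 + krall_e a beta n) s =
    pochhammer (krall_e a beta n) s * (krall_e a beta n + s%:R) / krall_e a beta n.
  by rewrite -pochhammer_shift mulrC mulKf.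
rewrite !invfM; set X := (pochhammer (a + 1) s)^-1; set Y := (s`!%:R)^-1.
by field; rewrite e0.
Qed.

(** In the singular case the series agrees with [krall] for all [b] near [beta] other than [beta],
    and the coefficients of [krall] are continuous at [beta]. *)
Lemma krallWE (R : realType) (alpha beta : R[i]) (j : int) n :
  let a := alpha + j%:~R in
  (a + n%:R) * n%:R + beta != 0 -> krall_e a beta n != 0 ->
  krallW alpha beta j n = krall a beta n.
Proof.
move=> a d0 e0; rewrite /krallW; case: ifPn => [en0|_].
  exact: krallW_formulaE.
apply/polyP => s; rewrite !coef_poly; case: ifP => // sn.
apply: (@cvg_lim R[i]^o); first exact: norm_hausdorff.
have idc : (id : R[i]^o -> R[i]^o) @ (beta : R[i]^o)^' --> (beta : R[i]^o).
  exact: nbhs_dnbhs.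
have cv := cvg_krall_coef (s := s) (dnbhs_filter _) d0 e0 idc.
apply: (cvg_trans _ cv); apply: near_eq_cvg.
(* Index [n + 1] yields both [e != 0], from the first factor, and [(e)_n != 0]. *)
have := near_pochhammer_neq0 (n%:R * (a + n%:R + 1)) (beta : R[i]^o) n.+1.
apply: filterS => b bn.
rewrite krallW_formulaE ?coef_poly ?sn//.
  by have /prodf_neq0/(_ ord0 isT) := bn; rewrite addr0.
by move: bn; rewrite pochhammerS mulf_eq0 => /norP[].
Qed.

Theorem mainTheorem7 (R : realType) (alpha beta : R[i]) (j : int)
  (alpha_nonint : forall k : int, alpha <> k%:~R)
  (beta_neq0 : beta <> 0)
  (Re_gtN1 : -1 < complex.Re (alpha + j%:~R))
  (nondeg : forall n : nat, (1 <= n)%N ->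
     n%:R * (alpha + j%:~R + n%:R) + beta <> 0 /\
     n%:R * (alpha + j%:~R + n%:R + 1) + beta <> 0) :
  (forall n : nat, krallW alpha beta j n \is monic /\
                   size (krallW alpha beta j n) = n.+1) /\
  exists q : nat -> R[i],
    (forall n : nat, q n <> 0) /\
    (forall n m : nat,
       let f := fun x : R => cpowR x (alpha + j%:~R)
         * (krallW alpha beta j n).[x%:C] * (krallW alpha beta j m).[x%:C] in
       cintegrable01 f /\
       cintegral01 f
       + beta^-1 * (krallW alpha beta j n).[1] * (krallW alpha beta j m).[1]
       = if n == m then q n else 0).
Proof.
set a := alpha + j%:~R in Re_gtN1 nondeg *.
(* Otherwise [alpha] would be the integer [-(j + k + 1)]. *)
have a_neg k : a + k.+1%:R != 0.
  apply/eqP => ak; apply: (alpha_nonint (- (j + k.+1%:Z))).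
  by apply/eqP; rewrite -subr_eq0 -ak /a rmorphN rmorphD /= opprK addrA.
have b0 : beta != 0 by exact/eqP.
(* The algebraic part also uses index 0, where the condition reads [beta != 0]. *)
have nd n : n%:R * (a + n%:R + 1) + beta != 0.
  case: n => [|n]; first by rewrite mul0r add0r.
  by have [_ /eqP] := nondeg n.+1 isT.
have nd' n : n%:R * (a + n%:R) + beta != 0.
  case: n => [|n]; first by rewrite mul0r add0r.
  by have [/eqP + _] := nondeg n.+1 isT.
have WE n : krallW alpha beta j n = krall a beta n.
  by apply: krallWE; [rewrite mulrC; exact: nd'|exact: krall_e_neq0].
split=> [n|].
  by rewrite WE; split; [exact: krall_monic|exact: size_krall].
exists (fun n => krall_form a beta (krall a beta n) 'X^n); split=> [n|n m f].
  by apply/eqP/krall_formXn_neq0.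
have : is_cintegral f (mom a (krall a beta n * krall a beta m)).
  apply: eq_is_cintegral (is_cintegral_cpowR_poly _ Re_gtN1) => x _.
  by rewrite /f !WE hornerM mulrA.
move=> /is_cintegral01[intf ->]; split=> //.
by rewrite !WE -krall_orthogonal.
Qed.
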